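(* Let $n>1$ and let $H=(h_{ij})$ be an $n\times n$ symmetric matrix with entries in $\{+1,-1\}$ satisfying $HH^{T}=nI$, with all diagonal entries equal to $+1$ and all row sums equal to a common positive constant. Let $G$ be the graph with vertex set $\{1,\dots,n\}$ in which distinct $i,j$ are adjacent if and only if $h_{ij}=+1$. Then $n$ is even and $G\in\mathfrak{Gr}(n,n/2+1)$.
   Context: All graphs are finite, simple and undirected. For a graph $G=(V,E)$ and $x\in V$, $N[x]=\{x\}\cup\{y: xy\in E\}$. A set $C\subseteq V$ is identifying if $N[x]\cap C\ne\emptyset$ for every $x\in V$ and $N[x]\cap C\neq N[y]\cap C$ for all distinct $x,y\in V$. For $n\ge k\ge1$, $\mathfrak{Gr}(n,k)$ is the set of graphs on $n$ vertices in which every $k$-element subset of vertices is identifying. *)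

(* Defs.v *)
From mathcomp Require Import all_boot.

Set Implicit Arguments.
Unset Strict Implicit.
Unset Printing Implicit Defensive.

Record sgraph (V : finType) := SGraph {
  adj : rel V;
  adj_sym : symmetric adj;
  adj_irr : irreflexive adj
}.

Definition closed_nbhd (V : finType) (G : sgraph V) (x : V) : {set V} :=
  x |: [set y | adj G x y].

Definition identifying (V : finType) (G : sgraph V) (C : {set V}) : Prop :=
  (forall x : V, closed_nbhd G x :&: C <> set0) /\
  (forall x y : V, x <> y -> closed_nbhd G x :&: C <> closed_nbhd G y :&: C).

(* Membership of G in Gr(n,k). As Gr(n,k) is only defined for n >= k >= 1, this
   range is part of the predicate; for k > n the last clause alone would hold
   vacuously. *)
Definition in_Gr (n k : nat) (V : finType) (G : sgraph V) : Prop :=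
  [/\ 1 <= k <= n, #|V| = n &
      forall C : {set V}, #|C| = k -> identifying G C].

(* Main.v *)
Require Import Defs.
From mathcomp Require Import all_boot all_order all_algebra.
From mathcomp Require Import zify.
Import Order.TTheory GRing.Theory Num.Theory.
Local Open Scope ring_scope.

(* Orthogonality of two distinct rows of H says that they agree in exactly n/2
   columns, so n is even and two closed neighbourhoods can only be
   indistinguishable on sets of at most n/2 vertices. A positive row sum says
   that each closed neighbourhood has more than n/2 vertices. *)

(** A sign [v] equals [2 * [v = 1] - 1], so summing signs amounts to counting the ones. *)
Lemma sum_pm1 (T : finType) (f : T -> int) :
  (forall i, f i = 1 \/ f i = -1) ->
  \sum_i f i = (#|[set i | f i == 1%R]| * 2)%N%:Z - #|T|%:Z.
Proof.
move=> f_pm1.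
have -> : \sum_i f i = \sum_i ((f i == 1)%:R * 2 - 1).
  by apply: eq_bigr => i _; case: (f_pm1 i) => ->.
rewrite sumrB -mulr_suml -natr_sum sumr_const PoszM !natz.
by rewrite -sum1dep_card [in RHS]big_mkcond.
Qed.

Theorem theorem29 (n : nat) (hn : (1 < n)%N) (H : 'M[int]_n)
    (H_sym : H^T = H)
    (H_pm1 : forall i j : 'I_n, H i j = 1 \/ H i j = -1)
    (H_hadamard : H *m H^T = (n%:R)%:M)
    (H_diag : forall i : 'I_n, H i i = 1)
    (H_rowsum : exists2 c : int, 0 < c & forall i : 'I_n, \sum_(j < n) H i j = c)
    (G : sgraph 'I_n)
    (G_adj : forall i j : 'I_n, i <> j -> (adj G i j <-> H i j = 1)) :
  ~~ odd n /\ in_Gr n (n./2 + 1)%N G.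
Proof.
have nbhdE x : closed_nbhd G x = [set j | H x j == 1].
  apply/setP => j; rewrite !inE; have [->|/eqP nejx] := eqVneq j x.
    by rewrite H_diag eqxx.
  by apply/idP/eqP => /(G_adj x j (nesym nejx)).
(* The columns where rows [x] and [y] agree: a product of two signs is 1 exactly when they are
   equal. *)
pose A x y : {set 'I_n} := [set j | H x j * H y j == 1].
have cardA x y : x <> y -> (#|A x y| * 2 = n)%N.
  move=> /eqP nexy; have /matrixP/(_ x y) := H_hadamard.
  rewrite !mxE (negbTE nexy) mulr0n.
  under eq_bigr do rewrite mxE.
  rewrite sum_pm1 ?card_ord; first by move/subr0_eq=> [].
  by move=> j; case: (H_pm1 x j) (H_pm1 y j) => -> [] ->; [left|right|right|left].
have nbhd_gt x : (n < #|closed_nbhd G x| * 2)%N.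
  case: H_rowsum => c c_gt0 /(_ x); rewrite sum_pm1 // card_ord => row_x.
  by rewrite nbhdE -ltz_nat -subr_gt0 row_x.
have n_even : ~~ odd n.
  (* As [1 < n], the indices 0 and 1 give two distinct rows. *)
  have /cardA <- : Ordinal (ltnW hn) <> Ordinal hn by case.
  by rewrite oddM andbF.
split=> //; split; [by lia | exact: card_ord | move=> C cardC; split].
  (* A [C] missing the neighbourhood of [x] would fit in its complement, which has fewer than n/2
     vertices. *)
  move=> x /eqP; rewrite setIC setI_eq0 disjoints_subset => /subset_leq_card.
  have := nbhd_gt x; have := cardsC (closed_nbhd G x).
  by rewrite card_ord; lia.
move=> x y nexy eqC; have := cardA _ _ nexy.
(* Equal traces on [C] make the two rows agree on all n/2 + 1 columns of [C], one too many. *)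
suff /subset_leq_card : C \subset A x y by lia.
apply/subsetP => j jC; move/setP/(_ j): eqC.
by rewrite !nbhdE !inE jC !andbT; case: (H_pm1 x j) (H_pm1 y j) => -> [] ->.
Qed.
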